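(* Suppose that $\sup\{|v| : v\in \mathcal V\}<\infty$, where $\mathcal V$ is the support of the law $\Pi$ of $V$. Then there exists a strictly convex function $\phi:\mathbb R\to\mathbb R$ such that $T\phi=\phi=T_0\phi$.
   Context: Fix constants $c>0$, $\sigma>0$ and put $\hat c:=c\sigma^2$. $V$ is a real random variable with finite variance, possibly with atoms, so that $V=f(\eta)$ for some non-decreasing $f$ and a standard normal $\eta$; $\Pi$ is its law and $\mathcal V\subset\mathbb R$ its support. For measurable $\phi:\mathbb R\to\mathbb R$ and $\Psi:\mathcal V\to\mathbb R$ define $$T_1(\phi)(v):=\int_{\mathbb R}\exp\Big(\frac{yv-\phi(y)}{\hat c}\Big)\frac{1}{\sqrt{2\pi\sigma^2}}\exp\Big(-\frac{y^2}{2\sigma^2}\Big)dy,\quad v\in\mathcal V,$$ $$T_2(\Psi)(y):=\int_{\mathcal V}\exp\Big(\frac{yv-\Psi(v)}{\hat c}\Big)\Pi(dv),\quad y\in\mathbb R.$$ The domain $\mathcal D(T_i)$ consists of the measurable functions $g$ for which $T_i(g)$ takes values in $(0,\infty)$ everywhere. For $\phi\in\mathcal D(T_1)$ put $\Psi:=\hat c\log T_1(\phi)$, and let $\mathcal D(T)=\mathcal D(T_0)$ be the set of $\phi\in\mathcal D(T_1)$ such that $\Psi\in\mathcal D(T_2)$. On this domain $$T_0\phi(y):=\hat c\log T_2(\Psi)(y),\qquad T\phi(y):=\hat c\log\frac{T_2(\Psi)(y)}{T_2(\Psi)(0)},\quad y\in\mathbb R.$$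
   Formalization: V is additionally assumed not to be almost surely constant; if V = v0 a.s., every T_0 φ is affine, so no strictly convex φ with φ = T_0 φ exists and the claim as printed fails. *)

(* Defs.v *)
From HB Require Import structures.
From mathcomp Require Import all_boot all_order all_algebra.
From mathcomp Require Import all_classical all_reals all_analysis.
From mathcomp Require Import measurable_realfun.

Set Implicit Arguments.
Unset Strict Implicit.
Unset Printing Implicit Defensive.

Import Order.TTheory GRing.Theory Num.Theory.
Import numFieldNormedType.Exports.

Local Open Scope classical_set_scope.
Local Open Scope ring_scope.

Definition law_support (R : realType) (Pi : probability R R) : set R :=
  [set x | forall e : R, 0 < e -> (0 < Pi (ball x e))%E].

Lemma closed_law_support (R : realType) (Pi : probability R R) :
  closed (law_support Pi).
Proof.
move=> x xS e e0.
have e20 : 0 < e / 2 by rewrite divr_gt0.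
have [y [yS xy]] := xS _ (nbhsx_ballx x (e / 2) e20).
apply: (lt_le_trans (yS _ e20)); apply: le_measure.
- by rewrite inE; exact: measurable_ball.
- by rewrite inE; exact: measurable_ball.
- by move=> z yz; exact: (ball_split xy yz).
Qed.

(* Needed for [measurable_fun (law_support Pi)], in [dom_T2] below, not to be
   vacuous: it is conditional on the measurability of the domain. *)
Lemma measurable_law_support (R : realType) (Pi : probability R R) :
  measurable (law_support Pi).
Proof. by apply: closed_measurable; exact: closed_law_support. Qed.

(* Excludes V = v0 a.s., for which every function [T0 phi] is affine, so that
   no strictly convex fixed point exists. *)
Definition not_ae_constant d (T : measurableType d) (R : realType)
    (P : probability T R) (V : {RV P >-> R}) :=
  forall a : R, ~ {ae P, forall w, V w = a}.

Definition strictly_convex (R : realType) (phi : R -> R) :=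
  forall x y t : R, x != y -> 0 < t -> t < 1 ->
    phi (t * x + (1 - t) * y) < t * phi x + (1 - t) * phi y.

(* Functions on the support of [Pi], such as [T1 phi] and [Psi], are
   represented by total functions on [R] of which only the values on the
   support matter. *)
Section operators.
Context {R : realType}.
Variables (c sigma : R) (Pi : probability R R).

Definition chat : R := c * sigma ^+ 2.

Definition T1 (phi : R -> R) (v : R) : \bar R :=
  (\int[lebesgue_measure]_y
    (expR ((y * v - phi y) / chat) * normal_pdf 0 sigma y)%:E)%E.

Definition T2 (Psi : R -> R) (y : R) : \bar R :=
  (\int[Pi]_(v in law_support Pi) (expR ((y * v - Psi v) / chat))%:E)%E.

Definition dom_T1 : set (R -> R) :=
  [set phi | measurable_fun setT phi /\
    forall v, law_support Pi v -> (0 < T1 phi v < +oo)%E].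

Definition dom_T2 : set (R -> R) :=
  [set Psi | measurable_fun (law_support Pi) Psi /\
    forall y, (0 < T2 Psi y < +oo)%E].

Definition Psi_of (phi : R -> R) (v : R) : R := chat * ln (fine (T1 phi v)).

Definition dom_T : set (R -> R) := [set phi | dom_T1 phi /\ dom_T2 (Psi_of phi)].

(* [T0] and [T] are total; they are meaningful on [dom_T] only. *)
Definition T0 (phi : R -> R) (y : R) : R :=
  chat * ln (fine (T2 (Psi_of phi) y)).

Definition T (phi : R -> R) (y : R) : R :=
  chat * ln (fine (T2 (Psi_of phi) y) / fine (T2 (Psi_of phi) 0)).

End operators.

(* Main.v *)
(** [T0] is monotone, commutes with adding constants and, the support of [Pi]
    being contained in [-M, M], maps M-Lipschitz functions to M-Lipschitz ones.
    For [l < 1] the discounted operator [phi |-> T0 (l phi)] therefore has a fixed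
    point by Knaster-Tarski. By Fubini, the integral of [expR ((T0 phi - phi) / chat)]
    against the normal density is 1 for every Lipschitz [phi]. This bounds the
    centering constants of the discounted fixed points, which hence become
    approximate subsolutions [psi <= T0 psi + o(1)] as [l] tends to 1. Their upper limit
    is a subsolution [phi <= T0 phi] (no compactness argument is needed), and the
    same integral identity forces [phi = T0 phi] almost everywhere. As [T0] only
    sees [phi] up to null sets, [T0 phi] is a fixed point. Strict convexity comes
    from the strict convexity of the exponential, [V] not being constant. *)
Require Import Defs.
From HB Require Import structures.
From mathcomp Require Import all_boot all_order all_algebra.
From mathcomp Require Import all_classical all_reals all_analysis.
From mathcomp Require Import measurable_realfun.
From mathcomp Require Import ring lra.

Import Order.TTheory GRing.Theory Num.Theory.
Import numFieldNormedType.Exports.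

Local Open Scope classical_set_scope.
Local Open Scope ring_scope.

(** * Integrals of non-negative functions, the support of a law, Gaussian moments *)

Section integral_zero.
Context (d : measure_display) (T : measurableType d) (R : realType).
Context (mu : {measure set T -> \bar R}) (D : set T) (f : T -> \bar R).
Hypotheses (mD : measurable D) (mf : measurable_fun D f).
Local Open Scope ereal_scope.

Lemma ge0_integral_eq0 :
  (forall x, D x -> 0 <= f x) -> \int[mu]_(x in D) f x = 0 ->
  ae_eq mu D f (cst 0).
Proof.
move=> f0 int0; apply/(ae_eq_integral_abs mu mD mf).
rewrite -int0; apply: eq_integral => x /set_mem Dx.
by rewrite gee0_abs ?f0.
Qed.

Lemma integral_gt0 :
  (forall x, D x -> 0 < f x) -> mu D != 0 -> 0 < \int[mu]_(x in D) f x.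
Proof.
move=> f0 muD; rewrite lt0e integral_ge0 ?andbT; last first.
  by move=> x Dx; exact/ltW/f0.
apply/eqP => /ge0_integral_eq0 -[x Dx|N [mN N0 sub]]; first exact/ltW/f0.
move/eqP: muD; apply; apply: (subset_measure0 _ _ _ N0) => // x Dx.
by apply: sub => /= /(_ Dx) fx0; have := f0 _ Dx; rewrite fx0 ltxx.
Qed.

End integral_zero.

(** A point outside the support has a null ball around it, hence lies in a null ball with rational
    centre and radius; there are only countably many of these. *)
Lemma law_support_full (R : realType) (Pi : probability R R) :
  (Pi (~` law_support Pi) = 0)%E.
Proof.
pose B n : set R := if (unpickle n : option (rat * rat)) is Some (q, r)
  then ball (ratr q : R) (ratr r) else set0.
pose N n : set R := if Pi (B n) == 0%E then B n else set0.
have mB n : measurable (B n).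
  by rewrite /B; case: (unpickle n) => [[q r]|//]; exact: measurable_ball.
have [] : Pi.-negligible (\bigcup_n N n).
  apply: negligible_bigcup => n; exists (N n); split=> //; rewrite /N.
    by case: ifP.
  by case: ifPn => [/eqP //|_]; rewrite measure0.
move=> A [mA A0 NA]; apply: (subset_measure0 _ _ _ A0) => //.
  by apply: measurableC; exact: measurable_law_support.
move=> x /existsNP[e /not_implyP[e0 /negP]].
rewrite -leNgt measure_le0 => /eqP Pe0; apply: NA.
(* Take a rational radius [r < e / 2] and a rational centre [q] within [r] of [x]: the ball at [q]
   contains [x] and lies in the null ball of radius [e]. *)
have [r /itvP re] := rat_in_itvoo (divr_gt0 e0 (ltr0Sn R 1)).
have r0 : 0 < ratr r :> R by rewrite re.
have xrx : x - ratr r < x by rewrite ltrBlDr ltrDl.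
have [q /itvP qx] := rat_in_itvoo xrx.
have xq : `|x - ratr q| < ratr r.
  by rewrite ger0_norm ?subr_ge0 ?(itvP qx) 1?ltW ?qx// ltrBlDr -ltrBlDl qx.
exists (pickle (q, r)) => //.
have BE : B (pickle (q, r)) = ball (ratr q : R) (ratr r) by rewrite /B pickleK.
rewrite /N (_ : Pi _ == 0)%E ?BE; first by rewrite /ball/= distrC.
apply/eqP/(subset_measure0 _ _ _ Pe0) => //; try exact: measurable_ball.
move=> z; rewrite /ball/= => qz.
rewrite (splitr e) (le_lt_trans (ler_distD (ratr q) _ _))// ltrD//.
  by rewrite (lt_trans xq)// re.
by rewrite (lt_trans qz)// re.
Qed.

Lemma normal_pdf_gt0 (R : realType) (m s x : R) :
  s != 0 -> 0 < normal_pdf m s x.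
Proof. by move=> s0; rewrite normal_pdfE// mulr_gt0 ?expR_gt0 ?normal_peak_gt0. Qed.

(* Completing the square. *)
Lemma expR_normal_pdf (R : realType) (s b x : R) : s != 0 ->
  expR (b * x) * normal_pdf 0 s x =
  expR (b ^+ 2 * s ^+ 2 / 2) * normal_pdf (b * s ^+ 2) s x.
Proof.
move=> s0; rewrite !normal_pdfE// /normal_fun mulrCA [RHS]mulrCA -!expRD.
by congr (_ * expR _); rewrite -mulr_natr; field.
Qed.

(** [expR (b * |x|)] is at most [expR (b * x) + expR (- b * x)], and completing the square turns
    each term into a multiple of a shifted normal density. *)
Lemma integrable_expR_normal_pdf (R : realType) (s C b : R) : s != 0 ->
  lebesgue_measure.-integrable setT
    (fun x : R => (expR (C + b * `|x|) * normal_pdf 0 s x)%:E).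
Proof.
move=> s0.
have mf : measurable_fun setT
    (fun x : R => (expR (C + b * `|x|) * normal_pdf 0 s x)%:E).
  apply/measurable_EFinP/measurable_funM; last exact: measurable_normal_pdf.
  apply: measurableT_comp => //; apply: measurable_funD => //.
  by apply: measurable_funM => //; exact: measurableT_comp.
have ie t : lebesgue_measure.-integrable setT
    (fun x : R => (expR C * expR (t ^+ 2 * s ^+ 2 / 2))%:E *
      (normal_pdf (t * s ^+ 2) s x)%:E)%E.
  by apply: integrableZl => //; exact: integrable_normal_pdf.
have E t x : expR C * expR (t ^+ 2 * s ^+ 2 / 2) * normal_pdf (t * s ^+ 2) s x =
    expR C * expR (t * x) * normal_pdf 0 s x.
  by rewrite -mulrA -(expR_normal_pdf R s t x s0) mulrA.
have le x : expR (C + b * `|x|) * normal_pdf 0 s x <=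
    expR C * expR (b ^+ 2 * s ^+ 2 / 2) * normal_pdf (b * s ^+ 2) s x +
    expR C * expR ((- b) ^+ 2 * s ^+ 2 / 2) * normal_pdf (- b * s ^+ 2) s x.
  rewrite (E b) (E (- b)) -(mulrDl (expR C * expR (b * x))) -(mulrDr (expR C)).
  rewrite ler_wpM2r ?normal_pdf_ge0// expRD ler_wpM2l ?expR_ge0//.
  have [x0|x0] := ler0P x; last by rewrite lerDl expR_ge0.
  by rewrite mulrN -mulNr lerDr expR_ge0.
have ge0 x : 0 <= expR (C + b * `|x|) * normal_pdf 0 s x.
  by apply: mulr_ge0; [exact: expR_ge0|exact: normal_pdf_ge0].
apply: (le_integrable _ _ _ (integrableD _ (ie b) (ie (- b)))) => // x _ /=.
apply: (le_trans _ (ler_norm _ : (_%:E <= `|_|%:E)%E)).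
by have := le x; rewrite -[in X in X -> _](ger0_norm (ge0 x)).
Qed.

(** * Lipschitz functions and convexity of the exponential *)

Definition lipschitz_le (R : realType) (M : R) (phi : R -> R) :=
  forall x y, `|phi x - phi y| <= M * `|x - y|.

Lemma lipschitz_le_continuous (R : realType) (M : R) (phi : R -> R) :
  lipschitz_le R M phi -> continuous phi.
Proof.
move=> L x; apply/cvgrPdist_lt => e e0; near=> y.
apply: (le_lt_trans (L x y)).
(* This constant dominates [M] and is positive whatever [M] is, so [e] can be divided by it. *)
have M1 : 0 < `|M| + 1 by rewrite ltr_wpDl.
apply: (@le_lt_trans _ _ ((`|M| + 1) * `|x - y|)).
  by rewrite ler_wpM2r// (le_trans (ler_norm _))// lerDl.
rewrite mulrC -ltr_pdivlMr//; near: y.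
by apply: cvgr_dist_lt; rewrite ?divr_gt0//; exact: cvg_id.
Unshelve. all: by end_near. Qed.

Lemma lipschitz_le_measurable (R : realType) (M : R) (phi : R -> R) :
  lipschitz_le R M phi -> measurable_fun setT phi.
Proof.
by move=> L; apply: continuous_measurable_fun; exact: lipschitz_le_continuous L.
Qed.

(** The tangent at the mean [m] lies strictly below the exponential away from [m]; after factoring
    out [expR m], the linear terms cancel in the weighted sum. *)
Lemma expR_strictly_convex (R : realType) (a b t : R) :
  a != b -> 0 < t -> t < 1 ->
  expR (t * a + (1 - t) * b) < t * expR a + (1 - t) * expR b.
Proof.
move=> ab t0 t1; set m := t * a + (1 - t) * b.
have am : a - m != 0.
  have -> : a - m = (1 - t) * (a - b) by rewrite /m; ring.
  by rewrite mulf_neq0// subr_eq0// gt_eqF.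
have tm : t * (a - m) + (1 - t) * (b - m) = 0 by rewrite /m; ring.
have ea : expR a = expR m * expR (a - m) by rewrite -expRD addrC subrK.
have eb : expR b = expR m * expR (b - m) by rewrite -expRD addrC subrK.
have hA : 0 < t * (expR (a - m) - (1 + (a - m))).
  by apply: mulr_gt0 => //; rewrite subr_gt0; exact: expR_gt1Dx.
have hB : 0 <= (1 - t) * (expR (b - m) - (1 + (b - m))).
  by apply: mulr_ge0; rewrite subr_ge0; [exact: ltW|exact: expR_ge1Dx].
have h1 : 1 < t * expR (a - m) + (1 - t) * expR (b - m) by lra.
by rewrite ea eb !(mulrCA _ (expR m)) -mulrDr ltr_pMr ?expR_gt0.
Qed.

(** Convexity between [0] and [z] gives the bound [1 - d + d * expR z]. Its purpose is to turn an
    exponent of order [d] into an error of order [d]. *)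
Lemma expR_mul_le (R : realType) (d z : R) : 0 < d -> d < 1 ->
  expR (d * z) <= 1 + d * expR z.
Proof.
move=> d0 d1; have [->|z0] := eqVneq z 0; first by rewrite mulr0 expR0; lra.
have := expR_strictly_convex _ _ _ _ z0 d0 d1.
by rewrite mulr0 addr0 expR0; lra.
Qed.

(** * Pointwise suprema of Lipschitz functions *)

Definition sup_fun (R : realType) (A : set (R -> R)) (y : R) : R :=
  sup [set f y | f in A].

Section lipschitz_functions.
Context (R : realType) (M : R).
Local Notation lip := (lipschitz_le R M).

Lemma lip_bound (phi : R -> R) y : lip phi -> `|phi y| <= `|phi 0| + M * `|y|.
Proof.
move=> L; have := L y 0; rewrite subr0 => Ly.
by rewrite -lerBlDl (le_trans _ Ly)// lerB_dist.
Qed.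

Lemma lipD (phi : R -> R) a : lip phi -> lip (fun y => phi y + a).
Proof. by move=> L x y; rewrite opprD addrACA subrr addr0. Qed.

Section sup_fun.
Context (A : set (R -> R)) (C : R).
Hypotheses (A_neq0 : A !=set0) (lip_A : forall f, A f -> lip f).
Hypothesis A_le : forall f, A f -> f 0 <= C.

Lemma has_sup_fun y : has_sup [set f y | f in A].
Proof.
split; first by have [f Af] := A_neq0; exists (f y), f.
exists (C + M * `|y|) => _ [f Af <-].
have := lip_A f Af y 0; rewrite subr0 => /ler_normlP[_ h].
by have := A_le f Af; lra.
Qed.

Lemma sup_fun_ge f y : A f -> f y <= sup_fun R A y.
Proof. by move=> Af; apply: sup_upper_bound; [exact: has_sup_fun|exists f]. Qed.

Lemma sup_fun_le b y : (forall f, A f -> f y <= b) -> sup_fun R A y <= b.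
Proof.
move=> h; apply: ge_sup; first by have [] := has_sup_fun y.
by move=> _ [f Af <-]; exact: h.
Qed.

(** Each [f] satisfies [f y <= f z + M * |y - z|], and this survives the supremum over [f]; the
    other direction is symmetric. *)
Lemma sup_fun_lip : lip (sup_fun R A).
Proof.
suff H y z : sup_fun R A y - sup_fun R A z <= M * `|y - z|.
  move=> y z; apply/ler_normlP; split; last exact: H.
  by rewrite opprB distrC; exact: H.
rewrite lerBlDr; apply: sup_fun_le => f Af.
have := sup_fun_ge f z Af; have /ler_normlP[_] := lip_A f Af y z; lra.
Qed.

End sup_fun.

Lemma lipZ (phi : R -> R) l : 0 <= l <= 1 -> lip phi -> lip (fun y => l * phi y).
Proof.
move=> /andP[l0 l1] L x y; rewrite -mulrBr normrM ger0_norm//.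
by apply: le_trans (L x y); rewrite ler_piMl.
Qed.

Lemma lip_norm a : `|a| <= M -> lip (fun y => a * `|y|).
Proof.
move=> aM x y; rewrite -mulrBr normrM; apply: ler_pM => //.
exact: ler_dist_dist.
Qed.

(** * Fixed points of the discounted operator *)

Section discounted.
Context (F : (R -> R) -> R -> R).
Hypothesis M0 : 0 <= M.
Hypothesis F_homo : forall phi psi y, lip phi -> lip psi ->
  (forall z, phi z <= psi z) -> F phi y <= F psi y.
Hypothesis F_D : forall phi a y, lip phi -> F (fun z => phi z + a) y = F phi y + a.
Hypothesis F_lip : forall phi, lip phi -> lip (F phi).

(* Knaster-Tarski on the complete lattice of Lipschitz functions with
   |phi 0| <= C, which the discounted operator preserves for large C. *)
Lemma discounted_fixpoint (l : R) : 0 < l < 1 ->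
  exists phi, lip phi /\ forall y, phi y = F (fun z => l * phi z) y.
Proof.
move=> /andP[l0 l1]; have l01 : 0 <= l <= 1 by rewrite !ltW.
have lip_up : lip (fun y => M * `|y|) by apply: lip_norm; rewrite ger0_norm.
have lip_dn : lip (fun y => - M * `|y|) by apply: lip_norm; rewrite normrN ger0_norm.
pose a := `|F (fun y => M * `|y|) 0| + `|F (fun y => - M * `|y|) 0|.
(* [C] solves [a + l * C = C]. The cones [M * |z|] and [- M * |z|], shifted by [l * C] up and down,
   enclose [l * phi], and [a] bounds the images of the unshifted cones at 0; hence [|phi 0| <= C] is
   preserved. *)
pose C := a / (1 - l).
have aC : a + l * C = C by rewrite /C; field; rewrite subr_eq0 gt_eqF.
have a0 : 0 <= a by rewrite addr_ge0.
have C0 : 0 <= C by rewrite divr_ge0// subr_ge0 ltW.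
have F0_le phi : lip phi -> `|phi 0| <= C -> `|F (fun z => l * phi z) 0| <= C.
  move=> L phi0; have Ll := lipZ phi l l01 L.
  have bnd z : - M * `|z| + - (l * C) <= l * phi z <= M * `|z| + l * C.
    have := lip_bound phi z L; move/ler_normlP => [h1 h2].
    have z0 := normr_ge0 z.
    have Mz : 0 <= M * `|z| by rewrite mulr_ge0.
    by apply/andP; split; nra.
  have := F_homo _ _ 0 Ll (lipD _ (l * C) lip_up) (fun z => proj2 (andP (bnd z))).
  have := F_homo _ _ 0 (lipD _ (- (l * C)) lip_dn) Ll (fun z => proj1 (andP (bnd z))).
  rewrite (F_D _ _ _ lip_up) (F_D _ _ _ lip_dn) => h1 h2.
  have := ler_norm (F (fun y => M * `|y|) 0).
  have := ler_norm (- F (fun y => - M * `|y|) 0); rewrite normrN => h3 h4.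
  have h5 := normr_ge0 (F (fun y => M * `|y|) 0).
  have h6 := normr_ge0 (F (fun y => - M * `|y|) 0).
  by apply/ler_normlP; split; move: aC; rewrite /a; lra.
(* The bounded subsolutions of the discounted equation; their supremum is the candidate fixed point,
   and the cone [- M * |y| - C] shows that there are some. *)
pose A := [set phi | [/\ lip phi, `|phi 0| <= C &
  forall y, phi y <= F (fun z => l * phi z) y]].
have lip_A phi : A phi -> lip phi by case.
have A_le phi : A phi -> phi 0 <= C by case=> _ /ler_normlP[].
have nrm0 : `|0 : R| = 0 by exact: normr0.
have A_bot : A (fun y => - M * `|y| + - C).
  have L := lipD _ (- C) lip_dn.
  have h0 : `|- M * `|0 : R| + - C| <= C by rewrite nrm0 mulr0 add0r normrN ger0_norm.
  split=> // y; have := F0_le _ L h0.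
  have := F_lip _ (lipZ _ l l01 L) y 0; rewrite subr0.
  by move=> /ler_normlP[h1 _] /ler_normlP[h2 _]; lra.
have A_neq0 : A !=set0 by eexists; exact: A_bot.
pose phi := sup_fun R A.
have L : lip phi := sup_fun_lip A C A_neq0 lip_A A_le.
have phi0 : `|phi 0| <= C.
  apply/ler_normlP; split; last exact: (sup_fun_le A C).
  have := sup_fun_ge A C A_neq0 lip_A A_le _ 0 A_bot.
  by rewrite nrm0 mulr0 add0r lerNl.
have Fle f g y : lip f -> lip g -> (forall z, f z <= g z) ->
    F (fun z => l * f z) y <= F (fun z => l * g z) y.
  move=> Lf Lg fg; apply: F_homo; [exact: lipZ|exact: lipZ|].
  by move=> z; rewrite ler_pM2l.
have phi_le y : phi y <= F (fun z => l * phi z) y.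
  apply: (sup_fun_le A C) => // f Af; case: (Af) => Lf _ fF.
  apply: le_trans (fF y) _; apply: Fle => // z.
  exact: (sup_fun_ge A C).
have LF := F_lip _ (lipZ _ l l01 L).
exists phi; split=> // y; apply/eqP; rewrite eq_le phi_le/=.
(* The discounted image of [phi] is again in [A], so it lies below the supremum [phi]. *)
apply: (sup_fun_ge A C) => //; split=> //; first exact: F0_le.
by move=> z; apply: Fle.
Qed.

(** The fixed point for [l = 1 - d] is centered at 0 by means of [F_D]. The error consists of a part
    of size at most [d * M * |y|] and of the constant [d * phi 0], which has to be controlled
    separately. *)
Lemma almost_fixpoint (d : R) : 0 < d < 1 ->
  exists phi, lip phi /\ let psi y := (1 - d) * (phi y - phi 0) in
    lip psi /\ forall y, F psi y = psi y + d * (phi y - phi 0) + d * phi 0.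
Proof.
move=> /andP[d0 d1]; have l01 : 0 < 1 - d < 1 by lra.
have [phi [L phiE]] := discounted_fixpoint (1 - d) l01.
exists phi; split=> //= ; pose psi y := (1 - d) * (phi y + - phi 0).
have Lpsi : lip psi by apply: lipZ; [lra|exact: lipD].
split=> // y.
have phiE' : (fun z => (1 - d) * phi z) = (fun z => psi z + (1 - d) * phi 0).
  by apply/funext => z; rewrite /psi; ring.
have FE : F psi y = phi y - (1 - d) * phi 0.
  by rewrite [in RHS]phiE phiE' (F_D _ _ _ Lpsi) addrK.
by rewrite [LHS]FE; ring.
Qed.

End discounted.

(** * Upper limits of approximate subsolutions *)

Section subsolution_limit.
Context (F : (R -> R) -> R -> R) (psi : nat -> R -> R) (K : R).
Hypothesis F_homo : forall phi psi y, lip phi -> lip psi ->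
  (forall z, phi z <= psi z) -> F phi y <= F psi y.
Hypothesis F_cvg : forall (u : nat -> R -> R) phi y, (forall n, lip (u n)) ->
  lip phi -> (forall n, u n 0 = 0) ->
  (forall y, u n y @[n --> \oo] --> phi y) -> F (u n) y @[n --> \oo] --> F phi y.
Hypothesis M0 : 0 <= M.
Hypothesis K0 : 0 <= K.
Hypothesis psi_lip : forall n, lip (psi n).
Hypothesis psi0 : forall n, psi n 0 = 0.
Hypothesis psi_le : forall n y, psi n y - n.+2%:R^-1 * (M * `|y| + K) <= F (psi n) y.

(* The upper limit of approximate subsolutions is a subsolution: the suprema of
   the tails decrease to it, and monotonicity of F suffices for each tail. *)
Lemma subsolution_limit : exists phi, lip phi /\ forall y, phi y <= F phi y.
Proof.
pose A n : set (R -> R) := [set psi m | m in [set m | (n <= m)%N]].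
have A_neq0 n : A n !=set0 by exists (psi n); exists n => /=.
have A_lip n f : A n f -> lip f by move=> [m _ <-].
have A_le n f : A n f -> f 0 <= 0 by move=> [m _ <-]; rewrite psi0.
pose u n := sup_fun R (A n).
have u_lip n : lip (u n) := sup_fun_lip (A n) 0 (A_neq0 n) (A_lip n) (A_le n).
have u_ge n m y : (n <= m)%N -> psi m y <= u n y.
  by move=> nm; apply: (sup_fun_ge (A n) 0 (A_neq0 n) (A_lip n) (A_le n)); exists m.
have u_le n y b : (forall m, (n <= m)%N -> psi m y <= b) -> u n y <= b.
  move=> h; apply: (sup_fun_le (A n) 0 (A_neq0 n) (A_lip n) (A_le n)) => f [m nm <-].
  exact: h.
have u0 n : u n 0 = 0.
  apply/eqP; rewrite eq_le -{3}(psi0 n) u_ge// andbT.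
  by apply: u_le => m _; rewrite psi0.
(* The suprema of the tails decrease in [n]; being Lipschitz and zero at 0, they stay above
   [- (M * |y|)]. *)
have u_cvg y : u n y @[n --> \oo] --> limn (fun n => u n y).
  apply: nonincreasing_is_cvgn.
    move=> n m nm; apply: u_le => p mp; apply: u_ge.
    exact: leq_trans mp.
  exists (- (M * `|y|)) => _ [n _ <-].
  by have := u_lip n y 0; rewrite subr0 u0 subr0 => /ler_normlP[]; lra.
pose phi y := limn (fun n => u n y).
have phi_lip : lip phi.
  move=> x y; apply: (@cvgr_to_le nat \oo _ R (fun n => `|u n x - u n y|)).
    exact: (cvg_norm (cvgB (u_cvg x) (u_cvg y))).
  by apply: nearW => n; exact: (u_lip n x y).
exists phi; split=> // y.
(* For [m >= n] the error of [psi m] is at most the one of index [n], and [psi m <= u n] gives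
   [F (psi m) <= F (u n)]; then the supremum over [m] is taken. *)
have Fu n : u n y - n.+2%:R^-1 * (M * `|y| + K) <= F (u n) y.
  rewrite lerBlDr; apply: u_le => m nm; rewrite -lerBlDr.
  apply: le_trans (F_homo _ _ y (psi_lip m) (u_lip n) (fun z => u_ge n m z nm)).
  apply: le_trans (psi_le m y); rewrite lerD2l lerN2.
  rewrite ler_wpM2r ?addr_ge0 ?mulr_ge0// lef_pV2 ?posrE ?ltr0n//.
  by rewrite ler_nat.
apply: (@ler_cvg_to nat \oo _ R (fun n => u n y - n.+2%:R^-1 * (M * `|y| + K))
  (fun n => F (u n) y)).
- rewrite -[X in _ --> X]subr0; apply: cvgB; first exact: u_cvg.
  rewrite -(mul0r (M * `|y| + K)); apply: cvgMl.
  by have := @cvg_harmonic R; rewrite -(cvg_shiftS (@harmonic R)).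
- exact: F_cvg.
- by apply: nearW => n; exact: Fu.
Qed.

End subsolution_limit.

End lipschitz_functions.

Arguments lip_bound {R M}.
Arguments lipD {R M}.

(* Locked, as unification would otherwise unfold and compare the integrals. *)
HB.lock Definition gauss_exp_moment (R : realType) (sigma C b : R) : R :=
  fine (\int[lebesgue_measure]_y (expR (C + b * `|y|) * normal_pdf 0 sigma y)%:E).

HB.lock Definition T1_fine (R : realType) (c sigma : R) (phi : R -> R) (v : R) : R :=
  fine (T1 c sigma phi v).

(** The integrand of [T2] at [Psi_of phi], after the exponential and the logarithm in [Psi_of] have
    cancelled. *)
Definition T2_kernel (R : realType) (c sigma : R) (phi : R -> R) (y v : R) : R :=
  expR (y * v / chat c sigma) / T1_fine R c sigma phi v.

HB.lock Definition T2_fine (R : realType) (c sigma : R) (Pi : probability R R)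
    (phi : R -> R) (y : R) : R :=
  fine (\int[Pi]_(v in law_support Pi) (T2_kernel R c sigma phi y v)%:E).

(** * Bounds and measurability of the two integrals for Lipschitz functions *)

Section fortet_operators.
Context (R : realType) (c sigma : R) (Pi : probability R R) (M : R).
Hypotheses (c_gt0 : 0 < c) (sigma_gt0 : 0 < sigma).
Hypothesis supp_le : forall v, law_support Pi v -> `|v| <= M.

Local Notation k := (chat c sigma).
Local Notation pdf := (normal_pdf 0 sigma).
Local Notation S := (law_support Pi).
Local Notation mu := (@lebesgue_measure R).
Local Notation lip := (lipschitz_le R M).
Local Notation exp_moment := (gauss_exp_moment R sigma).
Local Notation T1r := (T1_fine R c sigma).
Local Notation T2_integrand := (T2_kernel R c sigma).
Local Notation T2r := (T2_fine R c sigma Pi).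

Lemma chat_gt0 : 0 < k.
Proof. by rewrite mulr_gt0// exprn_gt0. Qed.

Lemma law_support_measure1 : Pi S = 1%E.
Proof.
have mS := measurable_law_support Pi.
have <- := probability_setT Pi; rewrite -(setvU S) measureU ?setICl//.
  by rewrite [X in (_ = X + _)%E]law_support_full add0e.
exact: measurableC.
Qed.

(** The support has mass 1, so it contains some [v], and [0 <= |v| <= M]. *)
Lemma M_ge0 : 0 <= M.
Proof.
have [S0|] := eqVneq S set0; last by move/set0P => [v /supp_le]; exact: le_trans.
have := law_support_measure1; rewrite S0 measure0 => /eqP.
by rewrite eq_sym onee_eq0.
Qed.

Lemma measurable_T1_integrand (phi : R -> R) : measurable_fun setT phi ->
  measurable_fun [set: R * R]
    (fun z => (expR ((z.2 * z.1 - phi z.2) / k) * pdf z.2)%:E).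
Proof.
move=> mphi; apply/measurable_EFinP/measurable_funM; last first.
  by apply: measurableT_comp => //; exact: measurable_normal_pdf.
apply: measurableT_comp => //; apply: measurable_funM => //.
apply: measurable_funB; first exact: measurable_funM.
exact: measurableT_comp.
Qed.

Lemma measurable_T1_integrand_r (phi : R -> R) v : measurable_fun setT phi ->
  measurable_fun [set: R]
    (fun y => (expR ((y * v - phi y) / k) * pdf y)%:E).
Proof.
move=> /measurable_T1_integrand mf.
exact: (measurableT_comp mf (measurable_pair1 v)).
Qed.

Lemma measurable_T1 (phi : R -> R) : measurable_fun setT phi ->
  measurable_fun setT (T1 c sigma phi).
Proof.
move=> /measurable_T1_integrand mf.
apply: (@measurable_fun_fubini_tonelli_F _ _ _ _ R mu _ mf) => z.
by rewrite lee_fin mulr_ge0 ?expR_ge0 ?normal_pdf_ge0.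
Qed.

Lemma exp_momentE C b :
  (exp_moment C b)%:E = (\int[mu]_y (expR (C + b * `|y|) * pdf y)%:E)%E.
Proof.
rewrite gauss_exp_moment.unlock fineK// integrable_fin_num//.
by apply: integrable_expR_normal_pdf; rewrite gt_eqF.
Qed.

Lemma exp_moment_gt0 C b : 0 < exp_moment C b.
Proof.
rewrite -lte_fin exp_momentE integral_gt0//.
- have := integrable_expR_normal_pdf R sigma C b (lt0r_neq0 sigma_gt0).
  by move/integrableP => [].
- by move=> y _; rewrite lte_fin mulr_gt0 ?expR_gt0 ?normal_pdf_gt0 ?gt_eqF.
- have : mu (`]-oo, +oo[%classic : set R) = +oo%E by rewrite lebesgue_measure_itv.
  rewrite set_itvE => muT; apply/eqP => mu0.
  by have := etrans (esym muT) mu0.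
Qed.

(** Combines [- phi y <= C + M * |y|] with [y * v <= B * |y|]. The bound [B] is kept apart from [M]
    in order to cover [v] outside the support as well. *)
Lemma T1_integrand_le (phi : R -> R) B C v y : lip phi -> `|phi 0| <= C -> `|v| <= B ->
  expR ((y * v - phi y) / k) * pdf y <= expR (C / k + (B + M) / k * `|y|) * pdf y.
Proof.
move=> L phi0 vB; rewrite ler_wpM2r ?normal_pdf_ge0// ler_expR.
rewrite mulrAC -mulrDl ler_pM2r ?invr_gt0 ?chat_gt0//.
have /ler_normlP[h _] := lip_bound phi y L.
have : y * v <= B * `|y|.
  by rewrite (le_trans (ler_norm _))// normrM mulrC ler_wpM2r.
lra.
Qed.

Lemma T1_integrand_ge (phi : R -> R) B C v y : lip phi -> `|phi 0| <= C -> `|v| <= B ->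
  expR (- C / k + - (B + M) / k * `|y|) * pdf y <=
  expR ((y * v - phi y) / k) * pdf y.
Proof.
move=> L phi0 vB; rewrite ler_wpM2r ?normal_pdf_ge0// ler_expR.
rewrite mulrAC -mulrDl ler_pM2r ?invr_gt0 ?chat_gt0//.
have /ler_normlP[_ h] := lip_bound phi y L.
have : - (y * v) <= B * `|y|.
  by rewrite (le_trans (ler_norm _))// normrN normrM mulrC ler_wpM2r.
lra.
Qed.

Lemma T1_le (phi : R -> R) B C v : lip phi -> `|phi 0| <= C -> `|v| <= B ->
  (T1 c sigma phi v <= (exp_moment (C / k) ((B + M) / k))%:E)%E.
Proof.
move=> L phi0 vB; have mphi := lipschitz_le_measurable R M phi L.
rewrite exp_momentE; apply: ge0_le_integral => //.
- by move=> y _; rewrite lee_fin mulr_ge0 ?expR_ge0 ?normal_pdf_ge0.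
- exact: measurable_T1_integrand_r.
- have := integrable_expR_normal_pdf R sigma (C / k) ((B + M) / k) (lt0r_neq0 sigma_gt0).
  by move/integrableP => [].
- by move=> y _; rewrite lee_fin; exact: T1_integrand_le.
Qed.

Lemma T1_ge (phi : R -> R) B C v : lip phi -> `|phi 0| <= C -> `|v| <= B ->
  ((exp_moment (- C / k) (- (B + M) / k))%:E <= T1 c sigma phi v)%E.
Proof.
move=> L phi0 vB; have mphi := lipschitz_le_measurable R M phi L.
rewrite exp_momentE; apply: ge0_le_integral => //.
- by move=> y _; rewrite lee_fin mulr_ge0 ?expR_ge0 ?normal_pdf_ge0.
- have := integrable_expR_normal_pdf R sigma (- C / k) (- (B + M) / k) (lt0r_neq0 sigma_gt0).
  by move/integrableP => [].
- exact: measurable_T1_integrand_r.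
- by move=> y _; rewrite lee_fin; exact: T1_integrand_ge.
Qed.

Lemma T1_bounded (phi : R -> R) v : lip phi -> (0 < T1 c sigma phi v < +oo)%E.
Proof.
move=> L; apply/andP; split.
  by rewrite (lt_le_trans _ (T1_ge _ `|v| `|phi 0| _ L _ _))// lte_fin exp_moment_gt0.
by rewrite (le_lt_trans (T1_le _ `|v| `|phi 0| _ L _ _))// ltry.
Qed.

Lemma T1rE (phi : R -> R) v : lip phi -> T1 c sigma phi v = (T1r phi v)%:E.
Proof.
move=> L; have /andP[T0 Ty] := T1_bounded phi v L.
by rewrite T1_fine.unlock fineK// fin_real// Ty (lt_trans _ T0).
Qed.

Lemma T1r_gt0 (phi : R -> R) v : lip phi -> 0 < T1r phi v.
Proof. by move=> L; rewrite -lte_fin -T1rE//; have /andP[] := T1_bounded phi v L. Qed.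

Lemma T1r_ge (phi : R -> R) C v : lip phi -> `|phi 0| <= C -> S v ->
  exp_moment (- C / k) (- (M + M) / k) <= T1r phi v.
Proof.
move=> L phi0 /supp_le vM; have := T1_ge phi M C v L phi0 vM.
by rewrite (T1rE phi v L) lee_fin.
Qed.

Lemma measurable_T1r (phi : R -> R) : measurable_fun setT phi -> measurable_fun setT (T1r phi).
Proof. by move=> /measurable_T1; rewrite T1_fine.unlock; exact: measurableT_comp. Qed.

Lemma T1r_homo (phi psi : R -> R) v : lip phi -> lip psi -> (forall y, phi y <= psi y) ->
  T1r psi v <= T1r phi v.
Proof.
move=> L L' le; suff : (T1 c sigma psi v <= T1 c sigma phi v)%E.
  by rewrite (T1rE phi v L) (T1rE psi v L') lee_fin.
apply: ge0_le_integral => //.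
- by move=> y _; rewrite lee_fin mulr_ge0 ?expR_ge0 ?normal_pdf_ge0.
- by apply: measurable_T1_integrand_r; exact: lipschitz_le_measurable L'.
- by apply: measurable_T1_integrand_r; exact: lipschitz_le_measurable L.
- move=> y _; rewrite lee_fin ler_wpM2r ?normal_pdf_ge0// ler_expR.
  by rewrite ler_pM2r ?invr_gt0 ?chat_gt0// lerD2l lerN2.
Qed.

Lemma T1rD (phi : R -> R) a v : lip phi ->
  T1r (fun y => phi y + a) v = expR (- a / k) * T1r phi v.
Proof.
move=> L; have mphi := lipschitz_le_measurable R M phi L.
have La : lip (fun y => phi y + a) by move=> x y; rewrite opprD addrACA subrr addr0.
apply: EFin_inj; rewrite -(T1rE _ v La) EFinM -(T1rE _ v L) -ge0_integralZl//.
- apply: eq_integral => y _; rewrite -EFinM mulrA -expRD; congr (expR _ * _)%:E.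
  by field; rewrite gt_eqF ?chat_gt0.
- exact: measurable_T1_integrand_r.
- by move=> y _; rewrite lee_fin mulr_ge0 ?expR_ge0 ?normal_pdf_ge0.
Qed.

Lemma T2_integrandE (phi : R -> R) y v : lip phi ->
  expR ((y * v - Psi_of c sigma phi v) / k) = T2_integrand phi y v.
Proof.
move=> L; rewrite mulrBl expRD; congr (_ * _).
rewrite /Psi_of mulrAC divff ?gt_eqF ?chat_gt0// mul1r expRN.
by rewrite (T1rE phi v L) lnK// posrE T1r_gt0.
Qed.

Lemma T2_integrand_gt0 (phi : R -> R) y v : lip phi -> 0 < T2_integrand phi y v.
Proof. by move=> L; rewrite divr_gt0 ?expR_gt0 ?T1r_gt0. Qed.

Lemma measurable_T2_integrand (phi : R -> R) : lip phi ->
  measurable_fun [set: R * R] (fun z => (T2_integrand phi z.1 z.2)%:E).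
Proof.
move=> L; have mphi := lipschitz_le_measurable R M phi L.
(* The reciprocal is written as [expR (- ln _)], a composition of measurable functions. *)
apply/measurable_EFinP; rewrite (_ : (fun z => _) =
    (fun z : R * R => expR (z.1 * z.2 / k) * expR (- ln (T1r phi z.2)))); last first.
  by apply/funext => z; rewrite expRN lnK// posrE T1r_gt0.
apply: measurable_funM; apply: measurableT_comp => //.
  by apply: measurable_funM => //; exact: measurable_funM.
apply: measurableT_comp => //; apply: measurableT_comp => //.
by apply: (measurableT_comp (measurable_T1r phi mphi)).
Qed.

Lemma measurable_T2_integrand_r (phi : R -> R) y : lip phi ->
  measurable_fun setT (fun v => (T2_integrand phi y v)%:E).
Proof.
move=> /measurable_T2_integrand mf.
exact: (measurableT_comp mf (measurable_pair1 y)).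
Qed.

(** The bound depends on [phi] only through [C] and not on [v], so it can serve as a dominating
    constant for a whole sequence. *)
Lemma T2_integrand_le (phi : R -> R) C y v : lip phi -> `|phi 0| <= C -> S v ->
  T2_integrand phi y v <=
  expR (M * `|y| / k) / exp_moment (- C / k) (- (M + M) / k).
Proof.
move=> L phi0 Sv; apply: ler_pM; rewrite ?expR_ge0 ?invr_ge0 ?(ltW (T1r_gt0 _ _ _))//.
  rewrite ler_expR ler_pM2r ?invr_gt0 ?chat_gt0// (le_trans (ler_norm _))//.
  by rewrite normrM mulrC ler_wpM2r ?supp_le.
rewrite lef_pV2 ?posrE ?exp_moment_gt0 ?T1r_gt0//.
exact: T1r_ge.
Qed.

Lemma T2_bounded (phi : R -> R) y : lip phi ->
  (0 < \int[Pi]_(v in S) (T2_integrand phi y v)%:E < +oo)%E.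
Proof.
move=> L; have mS := measurable_law_support Pi.
have mf : measurable_fun S (fun v => (T2_integrand phi y v)%:E).
  exact: measurable_funS (measurable_T2_integrand_r phi y L).
apply/andP; split.
  apply: integral_gt0 => //; first by move=> v _; rewrite lte_fin T2_integrand_gt0.
  by rewrite [X in X != _]law_support_measure1 onee_neq0.
pose B := expR (M * `|y| / k) / exp_moment (- `|phi 0| / k) (- (M + M) / k).
apply: (@le_lt_trans _ _ (\int[Pi]_(v in S) cst B%:E v)%E).
  apply: ge0_le_integral => //.
    by move=> v _; rewrite lee_fin (ltW (T2_integrand_gt0 _ _ _ _)).
  by move=> v Sv; rewrite lee_fin; exact: T2_integrand_le.
by rewrite integral_cst// [X in (_ * X)%E]law_support_measure1 mule1 ltry.
Qed.

Lemma T2rE (phi : R -> R) y : lip phi ->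
  (\int[Pi]_(v in S) (T2_integrand phi y v)%:E = (T2r phi y)%:E)%E.
Proof.
move=> L; have /andP[T0 Ty] := T2_bounded phi y L.
by rewrite T2_fine.unlock fineK// fin_real// Ty (lt_trans _ T0).
Qed.

Lemma T2r_gt0 (phi : R -> R) y : lip phi -> 0 < T2r phi y.
Proof.
by move=> L; have /andP[+ _] := T2_bounded phi y L; rewrite (T2rE phi y L) lte_fin.
Qed.

(** * Order, translations and Lipschitz bound for [T0] *)

Lemma T2E (phi : R -> R) y : lip phi ->
  T2 c sigma Pi (Psi_of c sigma phi) y = (T2r phi y)%:E.
Proof.
move=> L; rewrite -(T2rE phi y L); apply: eq_integral => v _.
by rewrite (T2_integrandE phi y v L).
Qed.

Lemma T0E (phi : R -> R) y : lip phi ->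
  T0 c sigma Pi phi y = k * ln (T2r phi y).
Proof. by move=> L; rewrite /T0 (T2E phi y L). Qed.

Lemma lip_dom_T (phi : R -> R) : lip phi -> dom_T c sigma Pi phi.
Proof.
move=> L; have mphi := lipschitz_le_measurable R M phi L.
split; split=> //; first by move=> v _; exact: T1_bounded.
  apply: measurable_funM => //; apply: measurableT_comp => //.
  have := measurable_T1r phi mphi; rewrite T1_fine.unlock.
  exact: measurable_funS.
by move=> y; rewrite (T2E phi y L) lte_fin T2r_gt0//= ltry.
Qed.

(** The quotient becomes a difference of logarithms. Hence a fixed point of [T0] that vanishes at 0
    is also fixed by [T]. *)
Lemma T_eq_T0 (phi : R -> R) y : lip phi ->
  T c sigma Pi phi y = T0 c sigma Pi phi y - T0 c sigma Pi phi 0.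
Proof.
move=> L; rewrite !(T0E phi _ L) /T !(T2E phi _ L)/= ln_div ?posrE ?T2r_gt0//.
by rewrite mulrBr.
Qed.

Lemma expR_T0 (phi : R -> R) y : lip phi ->
  expR (T0 c sigma Pi phi y / k) = T2r phi y.
Proof.
move=> L; rewrite (T0E phi y L) mulrAC divff ?gt_eqF ?chat_gt0// mul1r lnK//.
by rewrite posrE T2r_gt0.
Qed.

(** Order is reversed twice: by [T1] and by the reciprocal in the kernel. *)
Lemma T0_homo (phi psi : R -> R) y : lip phi -> lip psi ->
  (forall z, phi z <= psi z) -> T0 c sigma Pi phi y <= T0 c sigma Pi psi y.
Proof.
move=> L L' le; rewrite (T0E phi y L) (T0E psi y L').
rewrite ler_pM2l ?chat_gt0// ler_ln ?posrE ?T2r_gt0//.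
have mS := measurable_law_support Pi.
suff : (\int[Pi]_(v in S) (T2_integrand phi y v)%:E <=
        \int[Pi]_(v in S) (T2_integrand psi y v)%:E)%E.
  by rewrite (T2rE phi y L) (T2rE psi y L') lee_fin.
apply: ge0_le_integral => //.
- by move=> v _; rewrite lee_fin (ltW (T2_integrand_gt0 _ _ _ _)).
- exact: measurable_funS (measurable_T2_integrand_r phi y L).
- exact: measurable_funS (measurable_T2_integrand_r psi y L').
- move=> v Sv; rewrite lee_fin ler_wpM2l ?expR_ge0//.
  by rewrite lef_pV2 ?posrE ?T1r_gt0//; exact: T1r_homo.
Qed.

Lemma T0D (phi : R -> R) a y : lip phi ->
  T0 c sigma Pi (fun z => phi z + a) y = T0 c sigma Pi phi y + a.
Proof.
move=> L; have La := lipD phi a L.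
have mS := measurable_law_support Pi.
suff : (T2r (fun z => phi z + a) y)%:E = (expR (a / k) * T2r phi y)%:E.
  case=> E.
  rewrite (T0E _ y La) (T0E _ y L) E lnM ?posrE ?expR_gt0 ?T2r_gt0// expRK mulrDr.
  by rewrite addrC mulrCA divff ?mulr1// gt_eqF ?chat_gt0.
rewrite EFinM -(T2rE _ y La) -(T2rE _ y L) -ge0_integralZl//.
- apply: eq_integral => v _; rewrite -EFinM /T2_integrand; congr (_%:E).
  by rewrite (T1rD _ _ _ L) [(_ * T1r _ _)^-1]invfM (mulNr a k^-1) expRN invrK mulrCA.
- exact: measurable_funS (measurable_T2_integrand_r phi y L).
- by move=> v _; rewrite lee_fin (ltW (T2_integrand_gt0 _ _ _ _)).
Qed.

(** For [v] in the support, [y * v <= M * |y - z| + z * v]; exponentiating and integrating gives the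
    bound before the logarithm. *)
Lemma T0_lip (phi : R -> R) : lip phi -> lip (T0 c sigma Pi phi).
Proof.
move=> L; have mS := measurable_law_support Pi.
suff H y z : T0 c sigma Pi phi y - T0 c sigma Pi phi z <= M * `|y - z|.
  move=> y z; apply/ler_normlP; split; last exact: H.
  by rewrite opprB distrC; exact: H.
rewrite lerBlDr !(T0E phi _ L).
have -> : M * `|y - z| = k * ln (expR (M * `|y - z| / k)).
  by rewrite expRK mulrCA divff ?mulr1// gt_eqF ?chat_gt0.
rewrite -mulrDr -lnM ?posrE ?expR_gt0 ?T2r_gt0//.
rewrite ler_pM2l ?chat_gt0// ler_ln ?posrE ?mulr_gt0 ?expR_gt0 ?T2r_gt0//.
suff : ((T2r phi y)%:E <= (expR (M * `|y - z| / k) * T2r phi z)%:E)%E by rewrite lee_fin.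
have mT x := measurable_funS measurableT (@subsetT _ S) (measurable_T2_integrand_r phi x L).
have T0 x v : S v -> (0 <= (T2_integrand phi x v)%:E)%E.
  by move=> _; rewrite lee_fin (ltW (T2_integrand_gt0 _ _ _ _)).
rewrite EFinM -(T2rE _ y L) -(T2rE _ z L) -ge0_integralZl//; last exact: T0.
apply: ge0_le_integral => //; first exact: T0.
  by apply: measurable_funeM.
move=> v Sv; rewrite -EFinM lee_fin mulrA ler_wpM2r ?invr_ge0 ?(ltW (T1r_gt0 _ _ _))//.
rewrite -expRD ler_expR -mulrDl ler_pM2r ?invr_gt0 ?chat_gt0//.
rewrite -lerBlDr -mulrBl (le_trans (ler_norm _))// normrM mulrC ler_wpM2r//.
exact: supp_le.
Qed.

(** * The normalization identity *)

Lemma T2rE_setT (phi : R -> R) y : lip phi ->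
  (\int[Pi]_v (T2_integrand phi y v)%:E = (T2r phi y)%:E)%E.
Proof.
move=> L; have mS := measurable_law_support Pi.
rewrite -(T2rE phi y L) (ge0_negligible_integral (measurableC mS))//.
- by rewrite setTD setCK.
- exact: measurable_T2_integrand_r.
- by move=> v _; rewrite lee_fin (ltW (T2_integrand_gt0 _ _ _ _)).
- exact: law_support_full.
Qed.

Lemma measurable_T0 (phi : R -> R) : lip phi -> measurable_fun setT (T0 c sigma Pi phi).
Proof. by move=> /T0_lip /lipschitz_le_measurable. Qed.

(** After exchanging the integrals, the inner one over [y] is [T1 phi v], which cancels the
    denominator of the kernel; what remains is the total mass of [Pi]. *)
Lemma integral_T0 (phi : R -> R) : lip phi ->
  (\int[mu]_y (expR ((T0 c sigma Pi phi y - phi y) / k) * pdf y)%:E = 1)%E.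
Proof.
move=> L; have mphi := lipschitz_le_measurable R M phi L.
pose w y := expR (- phi y / k) * pdf y.
have mw : measurable_fun setT w.
  apply: measurable_funM; last exact: measurable_normal_pdf.
  by apply: measurableT_comp => //; apply: measurable_funM => //; exact: measurableT_comp.
have w0 y : 0 <= w y by rewrite mulr_ge0 ?expR_ge0 ?normal_pdf_ge0.
pose F (z : R * R) := (w z.1 * T2_integrand phi z.1 z.2)%:E.
have mF : measurable_fun setT F.
  apply/measurable_EFinP/measurable_funM; first exact: measurableT_comp.
  by have /measurable_EFinP := measurable_T2_integrand phi L.
have F0 z : (0 <= F z)%E.
  by rewrite lee_fin mulr_ge0// (ltW (T2_integrand_gt0 _ _ _ _)).
transitivity (\int[mu]_y \int[Pi]_v F (y, v))%E.
  apply: eq_integral => y _; rewrite /F/=.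
  under [in RHS]eq_integral do rewrite EFinM.
  rewrite ge0_integralZl//.
  - rewrite (T2rE_setT phi y L) -(expR_T0 phi y L) -EFinM; congr (_%:E).
    by rewrite /w mulrAC -expRD; congr (expR _ * _); rewrite mulrBl mulNr addrC.
  - exact: measurable_T2_integrand_r.
  - by move=> v _; rewrite lee_fin (ltW (T2_integrand_gt0 _ _ _ _)).
  - by rewrite lee_fin.
rewrite (@fubini_tonelli _ _ _ _ R mu Pi F mF F0).
transitivity (\int[Pi]_v (cst 1%E v))%E; last first.
  by rewrite integral_cst// [X in (_ * X)%E](probability_setT Pi) mule1.
apply: eq_integral => v _; rewrite /F/=.
transitivity (((T1r phi v)^-1)%:E * T1 c sigma phi v)%E; last first.
  by rewrite (T1rE phi v L) -EFinM mulVf// gt_eqF ?T1r_gt0.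
rewrite -ge0_integralZl//.
- apply: eq_integral => y _; rewrite -EFinM; congr (_%:E).
  by rewrite /w /T2_kernel mulrBl expRD mulNr; ring.
- exact: measurable_T1_integrand_r.
- by move=> y _; rewrite lee_fin mulr_ge0 ?expR_ge0 ?normal_pdf_ge0.
- by rewrite lee_fin invr_ge0 (ltW (T1r_gt0 _ _ _)).
Qed.

(** * Pointwise limits and strict convexity of the images *)

Section convergence.
Context (u : nat -> R -> R) (phi : R -> R) (C : R).
Hypotheses (lip_u : forall n, lip (u n)) (lip_phi : lip phi).
Hypothesis u0 : forall n, `|u n 0| <= C.
Hypothesis u_phi : forall y, u n y @[n --> \oo] --> phi y.

(** Dominated convergence: [M] and [C] provide one envelope, integrable against the normal density,
    for all [n]. *)
Lemma T1r_cvg v : T1r (u n) v @[n --> \oo] --> T1r phi v.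
Proof.
have s0 := lt0r_neq0 sigma_gt0.
pose f n y := (expR ((y * v - u n y) / k) * pdf y)%:E.
have cvg_f : {ae mu, forall y, setT y ->
    f ^~ y @ \oo --> (expR ((y * v - phi y) / k) * pdf y)%:E}.
  apply: aeW => y _; apply: cvg_EFin; first by near=> n.
  apply: cvgMl; apply: continuous_cvg; first exact: continuous_expR.
  by apply: cvgMl; apply: cvgB; [exact: cvg_cst|exact: u_phi].
have dom_f : {ae mu, forall y n, setT y ->
    (`|f n y| <= (expR (C / k + (`|v| + M) / k * `|y|) * pdf y)%:E)%E}.
  apply: aeW => y n _.
  rewrite gee0_abs ?lee_fin ?mulr_ge0 ?expR_ge0 ?normal_pdf_ge0//.
  exact: T1_integrand_le.
have mf n : measurable_fun setT (f n).
  by apply: measurable_T1_integrand_r; exact: lipschitz_le_measurable (lip_u n).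
have mphi := measurable_T1_integrand_r phi v (lipschitz_le_measurable _ _ _ lip_phi).
have [_ _] := @dominated_convergence _ _ R mu setT measurableT f _ _ mf mphi cvg_f
  (integrable_expR_normal_pdf R sigma _ _ s0) dom_f.
move=> h; suff /fine_cvg : (T1r (u n) v)%:E @[n --> \oo] --> (T1r phi v)%:E by [].
rewrite -(T1rE phi v lip_phi).
by under eq_fun do rewrite -(T1rE _ v (lip_u _)).
Unshelve. all: by end_near. Qed.

Lemma T2r_cvg y : T2r (u n) y @[n --> \oo] --> T2r phi y.
Proof.
have mS := measurable_law_support Pi.
pose B := expR (M * `|y| / k) / exp_moment (- C / k) (- (M + M) / k).
have mT f : lip f -> measurable_fun S (fun v => (T2_integrand f y v)%:E).
  by move=> L; exact: measurable_funS (measurable_T2_integrand_r f y L).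
have cvg_f : {ae Pi, forall v, S v ->
    (T2_integrand (u n) y v)%:E @[n --> \oo] --> (T2_integrand phi y v)%:E}.
  apply: aeW => v _; apply: cvg_EFin; first by near=> n.
  apply: cvgMr; apply: cvgV; first by rewrite gt_eqF ?T1r_gt0.
  exact: T1r_cvg.
have dom_f : {ae Pi, forall v n, S v ->
    (`|(T2_integrand (u n) y v)%:E| <= cst B%:E v)%E}.
  apply: aeW => v n Sv.
  rewrite gee0_abs ?lee_fin ?(ltW (T2_integrand_gt0 _ _ _ _))//.
  exact: T2_integrand_le.
have iB : Pi.-integrable S (cst B%:E) by exact: finite_measure_integrable_cst.
have [_ _] := @dominated_convergence _ _ R Pi S mS _ _ _
  (fun n => mT _ (lip_u n)) (mT _ lip_phi) cvg_f iB dom_f.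
move=> h; suff /fine_cvg : (T2r (u n) y)%:E @[n --> \oo] --> (T2r phi y)%:E by [].
rewrite -(T2rE phi y lip_phi).
by under eq_fun do rewrite -(T2rE _ y (lip_u _)).
Unshelve. all: by end_near. Qed.

Lemma T0_cvg y : T0 c sigma Pi (u n) y @[n --> \oo] --> T0 c sigma Pi phi y.
Proof.
rewrite (T0E phi y lip_phi); under eq_fun do rewrite (T0E _ y (lip_u _)).
apply: cvgMr; apply: (@continuous_cvg _ _ _ _ _ _ (@ln R)); last exact: T2r_cvg.
by apply: continuous_ln; rewrite T2r_gt0.
Qed.

End convergence.

(** If the inequality failed at [z], integrating the convexity gap of the exponential over [v] would
    give a non-positive value. The gap would then vanish almost everywhere, forcing [v] to be
    constant. *)
Lemma T0_strictly_convex (phi : R -> R) :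
  (forall a, ~ {ae Pi, forall v, v = a}) -> lip phi ->
  strictly_convex (T0 c sigma Pi phi).
Proof.
move=> nondeg L x y t xy t0 t1.
have k0 := chat_gt0.
have t1' : 0 < 1 - t by rewrite subr_gt0.
set z := t * x + (1 - t) * y.
set A := T0 c sigma Pi phi x; set B := T0 c sigma Pi phi y.
rewrite ltNge; apply/negP => mz.
(* [al] and [be] are logarithms of densities with respect to [Pi]: by the definition of [T0] at [x]
   and [y], their exponentials integrate to 1. *)
pose al v := (x * v - A) / k - ln (T1r phi v).
pose be v := (y * v - B) / k - ln (T1r phi v).
have TE (w D v : R) : expR ((w * v - D) / k - ln (T1r phi v)) =
    expR (- D / k) * T2_integrand phi w v.
  rewrite expRD expRN lnK ?posrE ?T1r_gt0// mulrBl expRD /T2_kernel.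
  by rewrite mulrA (mulrC (expR (- D / k))) mulNr.
have mexp (w D : R) : measurable_fun setT
    (fun v : R => (expR ((w * v - D) / k - ln (T1r phi v)))%:E).
  under eq_fun do rewrite TE EFinM.
  by apply: measurable_funeM; exact: measurable_T2_integrand_r.
have intexp (w D : R) : (\int[Pi]_v (expR ((w * v - D) / k - ln (T1r phi v)))%:E =
    (expR ((T0 c sigma Pi phi w - D) / k))%:E)%E.
  under eq_integral do rewrite TE EFinM.
  rewrite ge0_integralZl ?lee_fin ?expR_ge0//.
  - by rewrite (T2rE_setT phi w L) -(expR_T0 phi w L) -EFinM -expRD mulrBl addrC mulNr.
  - exact: measurable_T2_integrand_r.
  - by move=> v _; rewrite lee_fin (ltW (T2_integrand_gt0 _ _ _ _)).
have intZ (s w : R) : 0 <= s ->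
    (\int[Pi]_v (s%:E * (expR ((w * v - T0 c sigma Pi phi w) / k - ln (T1r phi v)))%:E)
     = s%:E)%E.
  move=> s0; have s0' : (0 <= s%:E)%E by rewrite lee_fin.
  have e0 (v : R) : setT v ->
    (0 <= (expR ((w * v - T0 c sigma Pi phi w) / k - ln (T1r phi v)))%:E)%E.
    by move=> _; rewrite lee_fin expR_ge0.
  rewrite (ge0_integralZl Pi measurableT (mexp w _) e0 s0').
  by rewrite intexp subrr mul0r expR0 mule1.
pose ga v := t * al v + (1 - t) * be v.
have gaE v : ga v = (z * v - (t * A + (1 - t) * B)) / k - ln (T1r phi v).
  by rewrite /ga /al /be /z; ring.
pose gap v := t * expR (al v) + (1 - t) * expR (be v) - expR (ga v).
have gap_gt0 v : al v != be v -> 0 < gap v.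
  by move=> ab; rewrite subr_gt0; exact: expR_strictly_convex.
have gap_ge0 v : 0 <= gap v.
  have [ab|/gap_gt0/ltW//] := eqVneq (al v) (be v).
  by rewrite /gap /ga ab -!mulrDl (addrC t) subrK !mul1r subrr.
have mga : measurable_fun setT (fun v => (expR (ga v))%:E).
  by under eq_fun do rewrite gaE; exact: mexp.
have msum : measurable_fun setT (fun v => (t * expR (al v) + (1 - t) * expR (be v))%:E).
  apply/measurable_EFinP/measurable_funD; apply: measurable_funM => //.
    by have /measurable_EFinP := mexp x A.
  by have /measurable_EFinP := mexp y B.
have mgap : measurable_fun setT (fun v => (gap v)%:E).
  apply/measurable_EFinP/measurable_funB.
    by have /measurable_EFinP := msum.
  by have /measurable_EFinP := mga.
have int1 : (\int[Pi]_v (gap v)%:E + \int[Pi]_v (expR (ga v))%:E = 1)%E.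
  rewrite -ge0_integralD//; try by move=> v _; rewrite lee_fin ?expR_ge0.
  transitivity (\int[Pi]_v (t%:E * (expR (al v))%:E + (1 - t)%:E * (expR (be v))%:E))%E.
    by apply: eq_integral => v _; rewrite -EFinD subrK.
  have e0 (r : R) : (0 <= (expR r)%:E)%E by rewrite lee_fin expR_ge0.
  have T0 : (0 <= t%:E)%E by rewrite lee_fin ltW.
  have T1 : (0 <= (1 - t)%:E)%E by rewrite lee_fin ltW.
  rewrite ge0_integralD//; try by move=> v _; rewrite mule_ge0.
  all: try by apply: measurable_funeM; exact: mexp.
  transitivity (t%:E + (1 - t)%:E)%E; last by rewrite -EFinD addrC subrK.
  by congr (_ + _)%E; apply: intZ; exact: ltW.
(* The failed inequality [mz] makes the integral of [expR (ga v)] at least 1, while adding the gap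
   to it gives exactly 1. *)
have gap0 : (\int[Pi]_v (gap v)%:E = 0)%E.
  move: int1; under [X in (_ + X)%E]eq_integral do rewrite gaE.
  rewrite intexp.
  have : 1 <= expR ((T0 c sigma Pi phi z - (t * A + (1 - t) * B)) / k).
    by rewrite -[leLHS]expR0 ler_expR divr_ge0 ?subr_ge0 ?(ltW k0).
  have : (0 <= \int[Pi]_v (gap v)%:E)%E.
    by apply: integral_ge0 => v _; rewrite lee_fin; exact: gap_ge0.
  case: (\int[Pi]_v (gap v)%:E)%E => [r| |]//=.
  rewrite lee_fin => r0 E1 [] rE; congr (_%:E).
  by apply/eqP; rewrite eq_le r0 andbT; lra.
have [N [mN N0 sub]] := ge0_integral_eq0 _ _ _ _ _ _ measurableT mgap
  (fun v _ => gap_ge0 v) gap0.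
(* [al v = be v] amounts to [v * (x - y) = A - B]. *)
apply: (nondeg ((A - B) / (x - y))); exists N; split=> // v vN.
apply: sub => /= /(_ I) gv0; apply: vN.
have ab : al v = be v.
  by apply/eqP; apply: contrapT => /negP /gap_gt0; case: gv0 => ->; rewrite ltxx.
have xy0 : x - y != 0 by rewrite subr_eq0.
have /eqP : k * (al v - be v) = 0 by rewrite ab subrr mulr0.
rewrite (_ : k * _ = v * (x - y) - (A - B)); last first.
  by rewrite /al /be; field; rewrite gt_eqF.
by rewrite subr_eq0 => /eqP <-; rewrite mulfK.
Qed.

(** * Existence of a Lipschitz fixed point *)

Local Notation F := (T0 c sigma Pi).

(* The normalization integral_T0 bounds the constant d * phi 0 below. *)
Lemma approximate_subsolution d : 0 < d < 1 ->
  exists psi, [/\ lip psi, psi 0 = 0 & forall y,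
    psi y - d * (M * `|y| + k * exp_moment 0 (M / k)) <= F psi y].
Proof.
move=> /[dup] d01 /andP[d0 d1].
have k0 := chat_gt0; have s0 := lt0r_neq0 sigma_gt0.
have [phi [L]] := almost_fixpoint R M F M_ge0 T0_homo T0D T0_lip d d01.
set psi := fun y => (1 - d) * (phi y - phi 0); rewrite /= => -[Lpsi FE].
exists psi; split=> //; first by rewrite /psi subrr mulr0.
have phi_le y : phi y - phi 0 <= M * `|y|.
  by have := L y 0; rewrite subr0 => /ler_normlP[].
have phi_ge y : 0 <= M * `|y| + (phi y - phi 0).
  by have := L y 0; rewrite subr0 => /ler_normlP[]; lra.
set e := expR (d * phi 0 / k); have e_ge0 : 0 <= e by exact: expR_ge0.
have ed_ge0 : 0 <= e * d by rewrite mulr_ge0// ltW.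
(* The exponent is [d * phi 0 / k] plus [d] times a quantity at most [M * |y| / k]; [expR_mul_le]
   treats the latter. The null terms give both summands the shape of [exp_moment]. *)
have growth y : expR ((F psi y - psi y) / k) <=
    e * expR (0 + 0 * `|y|) + e * d * expR (0 + M / k * `|y|).
  have -> : (F psi y - psi y) / k = d * phi 0 / k + d * ((phi y - phi 0) / k).
    by rewrite FE; field; rewrite gt_eqF.
  rewrite expRD -/e -(mulrA e) -(mulrDr e) ler_wpM2l//.
  apply: le_trans (expR_mul_le _ _ _ d0 d1) _.
  rewrite !add0r mul0r expR0 lerD2l ler_wpM2l ?(ltW d0)// ler_expR mulrAC.
  by rewrite ler_wpM2r ?invr_ge0 ?(ltW k0).
have mexp C b : measurable_fun setT (fun y : R => (expR (C + b * `|y|) * pdf y)%:E).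
  by have /integrableP[] := integrable_expR_normal_pdf R sigma C b s0.
have exp0 C b (y : R) : setT y -> (0 <= (expR (C + b * `|y|) * pdf y)%:E)%E.
  by move=> _; rewrite lee_fin mulr_ge0 ?expR_ge0 ?normal_pdf_ge0.
have intZ a C b : 0 <= a ->
    (\int[mu]_y (a%:E * (expR (C + b * `|y|) * pdf y)%:E) = (a * exp_moment C b)%:E)%E.
  move=> a0; have a0' : (0 <= a%:E)%E by rewrite lee_fin.
  by rewrite (ge0_integralZl mu measurableT (mexp C b) (exp0 C b) a0') -exp_momentE -EFinM.
have moment0 : exp_moment 0 0 = 1.
  apply: EFin_inj; rewrite exp_momentE -(integral_normal_pdf 0 sigma).
  by apply: eq_integral => y _; rewrite add0r mul0r expR0 mul1r.
(* Integrate [growth] against the normal density; by [integral_T0] the left side becomes 1. *)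
have int_le : 1 <= e * (1 + d * exp_moment 0 (M / k)).
  suff : (1 <= (e * exp_moment 0 0 + e * d * exp_moment 0 (M / k))%:E)%E.
    by rewrite lee_fin moment0 -(mulrA e) -(mulrDr e).
  rewrite EFinD -!intZ// -ge0_integralD//.
  - rewrite -(integral_T0 psi Lpsi); apply: ge0_le_integral => //.
    + by move=> y _; rewrite lee_fin mulr_ge0 ?expR_ge0 ?normal_pdf_ge0.
    + apply/measurable_EFinP/measurable_funM; last exact: measurable_normal_pdf.
      apply: measurableT_comp => //; apply: measurable_funM => //.
      by apply: measurable_funB; [exact: measurable_T0|exact: lipschitz_le_measurable Lpsi].
    + by apply: emeasurable_funD; apply: measurable_funeM; exact: mexp.
    + move=> y _; apply: (@le_trans _ _
        ((e * expR (0 + 0 * `|y|) + e * d * expR (0 + M / k * `|y|)) * pdf y)%:E).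
        by rewrite lee_fin ler_wpM2r ?normal_pdf_ge0.
      by rewrite -!EFinM -EFinD !mulrA -mulrDl.
  - by move=> y _; apply: mule_ge0; rewrite ?lee_fin//; exact: exp0.
  - by apply: measurable_funeM; exact: mexp.
  - by move=> y _; apply: mule_ge0; rewrite ?lee_fin//; exact: exp0.
  - by apply: measurable_funeM; exact: mexp.
(* Since [phi y - phi 0 >= - M * |y|], only a lower bound on [d * phi 0] is missing. It follows from
   [int_le] by [1 + x <= expR x] and monotonicity of the exponential. *)
suff key : - (d * (k * exp_moment 0 (M / k))) <= d * phi 0.
  move=> y; rewrite FE; move: key.
  have := mulr_ge0 (ltW d0) (phi_ge y).
  rewrite /psi; move: (exp_moment _ _) (phi y) (phi 0) => *; nra.
have : expR (- (d * phi 0 / k)) <= expR (d * exp_moment 0 (M / k)).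
  apply: (@le_trans _ _ (1 + d * exp_moment 0 (M / k))); last exact: expR_ge1Dx.
  by rewrite expRN -[leLHS]mulr1 ler_pdivrMl ?expR_gt0.
rewrite ler_expR => h.
have := ler_wpM2l (ltW k0) h.
rewrite mulrN [k * (d * phi 0 / k)]mulrC divfK ?gt_eqF//.
by rewrite lerNl mulrCA.
Qed.

(** [phi] enters [T0] only through the Lebesgue integral [T1]. *)
Lemma T0_ae_eq (phi psi : R -> R) : lip phi -> lip psi ->
  {ae mu, forall y, phi y = psi y} -> F phi = F psi.
Proof.
move=> L L' phipsi.
have T1E : T1 c sigma phi = T1 c sigma psi.
  apply/funext => v; apply: ge0_ae_eq_integral => //.
  - by apply: measurable_T1_integrand_r; exact: lipschitz_le_measurable L.
  - by apply: measurable_T1_integrand_r; exact: lipschitz_le_measurable L'.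
  - by move=> y _; rewrite lee_fin mulr_ge0 ?expR_ge0 ?normal_pdf_ge0.
  - by move=> y _; rewrite lee_fin mulr_ge0 ?expR_ge0 ?normal_pdf_ge0.
  - case: phipsi => N [mN N0 sub]; exists N; split=> // y /= neq; apply: sub => /= eq.
    by apply: neq => _; rewrite eq.
by apply/funext => y; rewrite /T0 /Psi_of T1E.
Qed.

(** For a subsolution [f >= pdf], yet both integrate to 1; so they agree almost everywhere, and the
    positive density can be divided out. *)
Lemma subsolution_ae_fixpoint (phi : R -> R) : lip phi ->
  (forall y, phi y <= F phi y) -> {ae mu, forall y, phi y = F phi y}.
Proof.
move=> L phi_le; have k0 := chat_gt0; have s0 := lt0r_neq0 sigma_gt0.
pose f y := expR ((F phi y - phi y) / k) * pdf y.
have mpdf : measurable_fun setT (fun y => (pdf y)%:E).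
  by apply/measurable_EFinP; exact: measurable_normal_pdf.
have mf : measurable_fun setT f.
  apply: measurable_funM; last exact: measurable_normal_pdf.
  apply: measurableT_comp => //; apply: measurable_funM => //.
  by apply: measurable_funB; [exact: measurable_T0|exact: lipschitz_le_measurable L].
have fpdf y : 0 <= f y - pdf y.
  rewrite subr_ge0 /f ler_peMl ?normal_pdf_ge0// -[leLHS]expR0 ler_expR.
  by rewrite divr_ge0 ?subr_ge0 ?(ltW k0).
have mdiff : measurable_fun setT (fun y => (f y - pdf y)%:E).
  by apply/measurable_EFinP/measurable_funB => //; exact: measurable_normal_pdf.
have : (\int[mu]_y ((f y - pdf y)%:E + (pdf y)%:E) = 1)%E.
  rewrite -(integral_T0 phi L); apply: eq_integral => y _.
  by rewrite -EFinD subrK.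
rewrite ge0_integralD//; last 2 first.
- by move=> y _; rewrite lee_fin.
- by move=> y _; rewrite lee_fin normal_pdf_ge0.
rewrite [X in (_ + X)%E](integral_normal_pdf 0 sigma) => int1.
have int0 : (\int[mu]_y (f y - pdf y)%:E = 0)%E.
  move: int1; case: (\int[mu]_y (f y - pdf y)%:E)%E => [r| |]//= [] r1.
  by congr (_%:E); lra.
have [N [mN N0 sub]] := ge0_integral_eq0 _ _ _ mu _ _ measurableT mdiff
  (fun y _ => fpdf y) int0.
exists N; split=> // y /= neq; apply: sub => /= /(_ I) [] /eqP; apply/negP/eqP.
apply: contra_not neq => /eqP.
rewrite /f -{2}[pdf y]mul1r -mulrBl mulf_eq0 (gt_eqF (normal_pdf_gt0 _ _ _ _ s0)) orbF.
rewrite subr_eq0 -expR0 => /eqP /expR_inj /eqP.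
by rewrite mulf_eq0 invr_eq0 (gt_eqF k0) orbF subr_eq0 => /eqP.
Qed.

Lemma T0_lip_fixpoint :
  exists phi, [/\ lip phi, phi 0 = 0 & F phi = phi].
Proof.
have k0 := chat_gt0; have M0 := M_ge0.
(* The offset 2 keeps the parameter strictly below 1 already for [n = 0]. *)
have d01 n : 0 < (n.+2%:R^-1 : R) < 1.
  by rewrite invr_gt0 ltr0n/= invf_lt1 ?ltr0n// ltr1n.
have /choice[psi psiP] : forall n, exists psi : R -> R, [/\ lip psi, psi 0 = 0 & forall y,
    psi y - n.+2%:R^-1 * (M * `|y| + k * exp_moment 0 (M / k)) <= F psi y].
  by move=> n; exact: approximate_subsolution (d01 n).
have F_cvg (u : nat -> R -> R) phi y : (forall n, lip (u n)) -> lip phi ->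
    (forall n, u n 0 = 0) -> (forall y, u n y @[n --> \oo] --> phi y) ->
    F (u n) y @[n --> \oo] --> F phi y.
  move=> Lu L u0 u_cvg; apply: (T0_cvg u phi 0) => // n.
  by rewrite u0 normr0.
have K0 : 0 <= k * exp_moment 0 (M / k).
  by apply: mulr_ge0; apply: ltW; [|exact: exp_moment_gt0].
have [phi [L phi_le]] := subsolution_limit R M F psi _ T0_homo F_cvg M0 K0
  (fun n => let: And3 h _ _ := psiP n in h) (fun n => let: And3 _ h _ := psiP n in h)
  (fun n => let: And3 _ _ h := psiP n in h).
have LF := T0_lip phi L.
have FF : F (F phi) = F phi.
  apply/esym/T0_ae_eq => //; exact: subsolution_ae_fixpoint.
(* Subtracting the value at 0 preserves the fixed point property, as [F] commutes with constants. *)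
exists (fun y => F phi y + - F phi 0); split; [exact: lipD|by rewrite subrr|].
by apply/funext => y; rewrite (T0D _ _ _ LF) FF.
Qed.

End fortet_operators.

Theorem theorem4p1 (R : realType) (c sigma : R) (c_gt0 : 0 < c)
    (sigma_gt0 : 0 < sigma)
    (d : measure_display) (Omega : measurableType d) (P : probability Omega R)
    (V eta : {RV P >-> R}) (f : R -> R)
    (V_variance : ('V_P[V] < +oo)%E)
    (V_nondegenerate : not_ae_constant V)
    (eta_normal : forall A : set R, measurable A ->
      distribution P eta A = normal_prob 0 1 A)
    (f_nondecreasing : {homo f : x y / x <= y})
    (V_eta : forall w : Omega, V w = f (eta w))
    (V_bounded :
      (ereal_sup [set `|v|%:E | v in law_support (distribution P V)] < +oo)%E) :
  exists phi : R -> R,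
    [/\ strictly_convex phi,
        dom_T c sigma (distribution P V) phi,
        T c sigma (distribution P V) phi = phi &
        T0 c sigma (distribution P V) phi = phi].
Proof.
have [M supp_le] : exists M : R, forall v,
    law_support (distribution P V) v -> `|v| <= M.
  (* Once the support has a point the supremum is not [-oo], and [V_bounded] excludes [+oo], so
     [fine] returns its true value. *)
  exists (fine (ereal_sup [set `|v|%:E | v in law_support (distribution P V)])).
  move=> v Sv; have : (`|v|%:E <= ereal_sup
      [set `|v|%:E | v in law_support (distribution P V)])%E.
    by apply: ereal_sup_ubound; exists v.
  by case: ereal_sup V_bounded => [r| |].
(* A null set of the law pulls back along [V] to a null set of [P]. *)
have nondeg a : ~ {ae distribution P V, forall v, v = a}.
  move=> [N [mN N0 sub]]; apply: (V_nondegenerate a).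
  exists (V @^-1` N); split=> //; last by move=> w /= Vw; exact: sub.
  by rewrite -[X in measurable X]setTI; exact: measurable_funP.
have [phi [L phi0 fix_phi]] :=
  T0_lip_fixpoint R c sigma (distribution P V) M c_gt0 sigma_gt0 supp_le.
exists phi; split=> //.
- rewrite -fix_phi.
  exact: (T0_strictly_convex R c sigma _ M c_gt0 sigma_gt0 supp_le).
- exact: (lip_dom_T R c sigma _ M c_gt0 sigma_gt0 supp_le).
- apply/funext => y.
  rewrite (T_eq_T0 R c sigma _ M c_gt0 sigma_gt0 supp_le _ _ L).
  by rewrite fix_phi phi0 subr0.
Qed.
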